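(* Let $n\ge2$ and let $1\le a_1\le a_2\le\dots\le a_n$ be integers. The complete $n$-partite graph $K(a_1,\dots,a_n)$ is exact if and only if one of the following holds: 1. (Balanced non-dominating case) There exists a subset $S\subset[n]$ such that $\sum_{i\in S}a_i=\sum_{j\notin S}a_j$. In this case the optimal objective value is $\left(\sum_{i\in S}a_i\right)^2$. 2. (Dominating case) $a_n\ge\sum_{i\ne n}a_i$. In this case the optimal objective value is $a_n\cdot\sum_{i\neq n}a_i$. Moreover, when $K(a_1,\dots,a_n)$ is exact, the optimal MAXCUT SDP solution is unique if and only if $a_n\ge\sum_{i<n}a_i$.
   Context: $[n]=\{1,\dots,n\}$. $K(a_1,\dots,a_n)$ denotes the (simple, unweighted, i.e. all edge weights equal to $1$) complete $n$-partite graph whose independent sets (parts) have sizes $a_1\le\dots\le a_n$. The Laplacian $\mathcal{L}_G$ of a graph $G=(V,E)$ with edge weights $w_{ij}$ ($w_{ij}=0$ for non-edges) is the $V\times V$ matrix with off-diagonal entries $-w_{ij}$ and diagonal entries $\sum_{j\ne i}w_{ij}$. The MAXCUT SDP of $G$ is: maximize $\frac14\langle \mathcal{L}_G,\mathbf{X}\rangle$ over symmetric matrices $\mathbf{X}\in\mathbb{R}^{V\times V}$ with $X_{ii}=1$ for all $i\in V$ and $\mathbf{X}\succeq \mathbf{0}$, where $\langle \mathbf{A},\mathbf{B}\rangle=\operatorname{tr}(\mathbf{A}\mathbf{B})$; the optimal objective value refers to this problem. $\mathrm{MAXCUT}(G)$ is the maximum, over partitions $(S,V\setminus S)$ of $V$,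 of the total weight of edges with exactly one endpoint in $S$. $G$ is called exact if the optimal value of the MAXCUT SDP of $G$ equals $\mathrm{MAXCUT}(G)$; equivalently, if the MAXCUT SDP has an optimal solution of rank $1$. *)

(* Defs.v *)
From HB Require Import structures.
From mathcomp Require Import all_boot all_order all_algebra.
From mathcomp Require Import reals.

Set Implicit Arguments.
Unset Strict Implicit.
Unset Printing Implicit Defensive.

Import Order.TTheory GRing.Theory Num.Theory.

Local Open Scope ring_scope.

(* A weight 0 means that there is no edge. *)
Record wgraph (R : realType) (V : finType) := WGraph {
  weight :> V -> V -> R;
  weight_sym : forall u v, weight u v = weight v u;
  weight_irr : forall u, weight u u = 0 }.

Section MaxCutSDP.
Variables (R : realType) (V : finType) (G : wgraph R V).
Implicit Types (X : 'M[R]_#|V|) (S : {set V}).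

(* V x V matrices are square matrices of order #|V|, where the row or column i
   stands for the vertex enum_val i. *)
Definition laplacian : 'M[R]_#|V| :=
  \matrix_(i, j) if i == j then \sum_(k | k != enum_val i) G (enum_val i) k
                 else - G (enum_val i) (enum_val j).

Definition psdmx (m : nat) (X : 'M[R]_m) : Prop :=
  X^T = X /\ forall x : 'cV[R]_m, 0 <= (x^T *m X *m x) ord0 ord0.

Definition sdp_feasible X : Prop := (forall i, X i i = 1) /\ psdmx X.

Definition sdp_objective X : R := 4^-1 * \tr (laplacian *m X).

Definition sdp_optimal X : Prop :=
  sdp_feasible X /\
  forall Y, sdp_feasible Y -> sdp_objective Y <= sdp_objective X.

Definition sdp_value (v : R) : Prop :=
  exists2 X, sdp_optimal X & sdp_objective X = v.

Definition cut_weight S : R := \sum_(u in S) \sum_(v in ~: S) G u v.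

(* The default value 0 of the iterated maximum is the weight of the cut given
   by S = set0, so it is harmless even for negative weights. *)
Definition maxcut : R := \big[Num.max/0]_(S : {set V}) cut_weight S.

Definition exact_graph : Prop := sdp_value maxcut.

End MaxCutSDP.

(* The vertex set of K(a_0, ..., a_(n-1)): the vertex Tagged _ (k : 'I_(a i)) is
   the k-th vertex of part i. *)
Definition Kpart_vertex (n : nat) (a : 'I_n -> nat) : finType :=
  {i : 'I_n & 'I_(a i)}.

Definition Kpart_weight (R : realType) (n : nat) (a : 'I_n -> nat)
  (u v : Kpart_vertex a) : R := (tag u != tag v)%:R.

Lemma Kpart_weight_sym (R : realType) (n : nat) (a : 'I_n -> nat)
  (u v : Kpart_vertex a) : Kpart_weight R u v = Kpart_weight R v u.
Proof. by rewrite /Kpart_weight eq_sym. Qed.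

Lemma Kpart_weight_irr (R : realType) (n : nat) (a : 'I_n -> nat)
  (u : Kpart_vertex a) : Kpart_weight R u u = 0.
Proof. by rewrite /Kpart_weight eqxx. Qed.

Definition Kpart (R : realType) (n : nat) (a : 'I_n -> nat) :
    wgraph R (Kpart_vertex a) :=
  WGraph (@Kpart_weight_sym R n a) (@Kpart_weight_irr R n a).

(* Main.v *)
Require Import Defs.
From mathcomp Require Import all_boot all_order all_algebra.
From mathcomp Require Import reals.
From mathcomp Require Import ring lra zify.

Import Order.TTheory GRing.Theory Num.Theory.

Local Open Scope ring_scope.

(** A feasible X is the Gram matrix of unit vectors x_u, and the proof argues
    with these vectors; concretely it only uses the entries
    [entry X u v] = x_u . x_v and the fact that X is positive semidefinite.
    Let N be the number of vertices and A = a ord_max, B = N - A.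

    Upper bound N^2/4. Four times the objective is N^2 - |Y|^2 minus the sum of
    1 - x_u . x_v over pairs in a common part, where Y is the sum of all x_u
    ([Kpart_objectiveE]). Hence the value N^2/4 is attained exactly when each
    part i is sent to a single unit vector z_i and the sum of the a_i z_i is
    zero. For a cut the z_i are signs, so a cut attains N^2/4 only if the signs
    split the a_i into two equal halves ([balanced_of_cut]); conversely such a
    split gives an optimal cut ([balanced_closed_config]).

    If A < B, the value of the relaxation is N^2/4 whether or not the graph is
    exact: the other parts can be put into two groups that form, together with
    part ord_max, the sides of a triangle, and the directions of its sides are
    the z_i ([nondominating_closed_config]). So exactness forces a balanced
    split. Then every part is smaller than N/2, so each half of the split can
    be divided further, and the resulting degenerate quadrilateral can be bent;
    this gives a second optimal matrix ([balanced_bent_config]).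

    If B <= A, a dual certificate bounds the objective by A B, the weight of
    the cut that separates part ord_max from the rest ([dominating_bound]). In
    the case of equality every x_v outside part ord_max is the antipode of
    every x_u in it, which leaves only one matrix ([dominating_unique]). *)

(** * The semidefinite program in terms of entries *)

(** Indexing by vertices makes the enumeration of V disappear from all later
    arguments. *)
Definition entry {R : realType} {V : finType} (X : 'M[R]_#|V|) (u v : V) : R :=
  X (enum_rank u) (enum_rank v).

Lemma sum_enum_rank {R : realType} {V : finType} (F : 'I_#|V| -> R) :
  \sum_i F i = \sum_(u : V) F (enum_rank u).
Proof.
rewrite (reindex (@enum_rank V)) //=.
by exists enum_val => i _; [exact: enum_rankK | exact: enum_valK].
Qed.

Lemma entry_inj {R : realType} {V : finType} (X Y : 'M[R]_#|V|) :
  (forall u v, entry X u v = entry Y u v) -> X = Y.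
Proof.
move=> XY; apply/matrixP => i j.
by have := XY (enum_val i) (enum_val j); rewrite /entry !enum_valK.
Qed.

Lemma entry_sym {R : realType} {V : finType} (X : 'M[R]_#|V|) u v :
  sdp_feasible X -> entry X u v = entry X v u.
Proof. by case=> _ [XT _]; rewrite /entry -{1}XT mxE. Qed.

Lemma entry_diag {R : realType} {V : finType} (X : 'M[R]_#|V|) u :
  sdp_feasible X -> entry X u u = 1.
Proof. by case=> X1 _; apply: X1. Qed.

Lemma sdp_objectiveE {R : realType} {V : finType} (G : wgraph R V)
    (X : 'M[R]_#|V|) :
  sdp_feasible X ->
  4 * sdp_objective G X = \sum_u \sum_v G u v * (1 - entry X u v).
Proof.
move=> fX; rewrite /sdp_objective mulrA mulfV ?pnatr_eq0 // mul1r.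
rewrite /mxtrace sum_enum_rank; apply: eq_bigr => u _.
rewrite mxE sum_enum_rank (bigD1 u) //= [RHS](bigD1 u) //=.
rewrite weight_irr mul0r add0r mxE eqxx enum_rankK -/(entry X u u).
rewrite entry_diag // mulr1 -big_split /=; apply: eq_bigr => v vu.
rewrite mxE !enum_rankK (inj_eq enum_rank_inj) eq_sym (negPf vu).
by rewrite -/(entry X v u) (entry_sym X v u) // mulrBr mulr1 mulNr.
Qed.

Lemma entry_quad_ge0 {R : realType} {V : finType} (X : 'M[R]_#|V|)
    (c : V -> R) :
  sdp_feasible X -> 0 <= \sum_u \sum_v c u * c v * entry X u v.
Proof.
case=> _ [_ /(_ (\col_i c (enum_val i)))]; congr (_ <= _).
rewrite mxE sum_enum_rank exchange_big; apply: eq_bigr => v _ /=.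
rewrite !mxE sum_enum_rank mulr_suml; apply: eq_bigr => u _.
by rewrite !mxE !enum_rankK /entry mulrAC.
Qed.

Lemma sum_pred1 {R : realType} {V : finType} (F : V -> R) (u : V) :
  \sum_v (v == u)%:R * F v = F u.
Proof.
rewrite (bigD1 u) //= eqxx mul1r big1 ?addr0 // => v /negPf->.
by rewrite mul0r.
Qed.

(** With W the combination of the x_v with coefficients c, this is
    (W . x_u)^2 <= |W|^2, the Cauchy-Schwarz inequality for the unit vector
    x_u. *)
Lemma entry_cauchy_schwarz {R : realType} {V : finType} (X : 'M[R]_#|V|)
    (c : V -> R) u :
  sdp_feasible X ->
  (\sum_v c v * entry X u v) ^+ 2 <= \sum_v \sum_w c v * c w * entry X v w.
Proof.
(* test positivity on W - s x_u, the component of W orthogonal to x_u *)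
move=> fX; set s := (X in X ^+ 2); rewrite -subr_ge0.
have := entry_quad_ge0 X (fun v => c v - s * (v == u)%:R) fX.
congr (_ <= _).
have E v : \sum_w (c v - s * (v == u)%:R) * (c w - s * (w == u)%:R)
             * entry X v w
    = \sum_w c v * c w * entry X v w - s * (c v * entry X u v)
      - s * ((v == u)%:R * \sum_w c w * entry X v w)
      + s ^+ 2 * ((v == u)%:R * entry X v u).
  transitivity (\sum_w (c v * c w * entry X v w
     - s * c v * ((w == u)%:R * entry X v w)
     - s * (v == u)%:R * (c w * entry X v w)
     + s ^+ 2 * (v == u)%:R * ((w == u)%:R * entry X v w))).
    by apply: eq_bigr => w _; ring.
  rewrite big_split !sumrB /= -!mulr_sumr !sum_pred1 (entry_sym X v u) //.
  by ring.
rewrite (eq_bigr _ (fun v _ => E v)) big_split !sumrB /= -!mulr_sumr.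
by rewrite !sum_pred1 entry_diag // -/s; ring.
Qed.

Lemma entry_sqr_le1 {R : realType} {V : finType} (X : 'M[R]_#|V|) u v :
  sdp_feasible X -> entry X u v ^+ 2 <= 1.
Proof.
move=> fX; have := entry_cauchy_schwarz X (fun w => (w == v)%:R) u fX.
rewrite sum_pred1; congr (_ <= _).
under eq_bigr do under eq_bigr do rewrite -mulrA.
by under eq_bigr do rewrite -mulr_sumr sum_pred1; rewrite sum_pred1 entry_diag.
Qed.

Lemma entry_ge {R : realType} {V : finType} (X : 'M[R]_#|V|) u v :
  sdp_feasible X -> 0 <= 1 + entry X u v.
Proof. by move=> /(entry_sqr_le1 X u v) h; nra. Qed.

Lemma entry_le {R : realType} {V : finType} (X : 'M[R]_#|V|) u v :
  sdp_feasible X -> 0 <= 1 - entry X u v.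
Proof. by move=> /(entry_sqr_le1 X u v) h; nra. Qed.

(** If x_u . x_v = -1 then x_u + x_v has length zero, hence is orthogonal to
    every x_w by Cauchy-Schwarz. *)
Lemma entry_antipodal {R : realType} {V : finType} (X : 'M[R]_#|V|) u v w :
  sdp_feasible X -> entry X u v = -1 -> entry X v w = - entry X u w.
Proof.
move=> fX uv.
have := entry_cauchy_schwarz X (fun x => (x == u)%:R + (x == v)%:R) w fX.
have -> : \sum_x \sum_y ((x == u)%:R + (x == v)%:R) *
    ((y == u)%:R + (y == v)%:R) * entry X x y = 0.
  have E x : \sum_y ((x == u)%:R + (x == v)%:R) *
      ((y == u)%:R + (y == v)%:R) * entry X x y =
      (x == u)%:R * (entry X x u + entry X x v) +
      (x == v)%:R * (entry X x u + entry X x v).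
    rewrite -mulrDl -(sum_pred1 (entry X x) u) -(sum_pred1 (entry X x) v).
    by rewrite -big_split mulr_sumr /=; apply: eq_bigr => y _; ring.
  rewrite (eq_bigr _ (fun x _ => E x)) big_split /= !sum_pred1.
  by rewrite !entry_diag // (entry_sym X v u) // uv; ring.
under eq_bigr do rewrite mulrDl.
rewrite big_split /= !sum_pred1 (entry_sym X w u) // (entry_sym X w v) //.
by move=> h; nra.
Qed.

(** * Gram matrices of planar configurations *)

Definition planar_gram {R : realType} {V : finType} (f g : V -> R) :
    'M[R]_#|V| :=
  \matrix_(i, j) (f (enum_val i) * f (enum_val j)
                  + g (enum_val i) * g (enum_val j)).

Lemma entry_planar_gram {R : realType} {V : finType} (f g : V -> R) u v :
  entry (planar_gram f g) u v = f u * f v + g u * g v.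
Proof. by rewrite /entry mxE !enum_rankK. Qed.

Lemma planar_gram_feasible {R : realType} {V : finType} (f g : V -> R) :
  (forall u, f u ^+ 2 + g u ^+ 2 = 1) -> sdp_feasible (planar_gram f g).
Proof.
move=> fg; split=> [i|]; first by rewrite mxE -!expr2 fg.
split=> [|x]; first by apply/matrixP => i j; rewrite !mxE; ring.
have -> : (x^T *m planar_gram f g *m x) ord0 ord0 =
    (\sum_i x i ord0 * f (enum_val i)) ^+ 2 +
    (\sum_i x i ord0 * g (enum_val i)) ^+ 2.
  rewrite mxE !expr2 !mulr_suml -big_split; apply: eq_bigr => j _ /=.
  rewrite !mulr_sumr mxE mulr_suml -big_split /=.
  by apply: eq_bigr => i _; rewrite !mxE; ring.
by rewrite addr_ge0 ?sqr_ge0.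
Qed.

(** * Cuts as rank-one feasible matrices *)

Definition cut_gram {R : realType} {V : finType} (T : {set V}) : 'M[R]_#|V| :=
  planar_gram (fun u => (-1) ^+ (u \in T)) (fun=> 0).

Lemma entry_cut_gram {R : realType} {V : finType} (T : {set V}) u v :
  entry (cut_gram T) u v = (-1) ^+ (u \in T) * (-1) ^+ (v \in T) :> R.
Proof. by rewrite entry_planar_gram mulr0 addr0. Qed.

Lemma cut_gram_feasible {R : realType} {V : finType} (T : {set V}) :
  @sdp_feasible R V (cut_gram T).
Proof.
by apply: planar_gram_feasible => u; rewrite /= expr0n addr0 sqrr_sign.
Qed.

Lemma sdp_objective_cut_gram {R : realType} {V : finType} (G : wgraph R V)
    (T : {set V}) :
  sdp_objective G (cut_gram T) = cut_weight G T.
Proof.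
apply: (@mulfI _ 4); rewrite ?pnatr_eq0 // sdp_objectiveE; last first.
  exact: cut_gram_feasible.
have cutE (S : {set V}) : cut_weight G S =
    \sum_u \sum_v (u \in S)%:R * (v \notin S)%:R * G u v.
  rewrite /cut_weight big_mkcond; apply: eq_bigr => u _.
  case: (u \in S); last by rewrite big1 // => v _; rewrite !mul0r.
  rewrite big_mkcond; apply: eq_bigr => v _; rewrite inE.
  by case: (v \in S); rewrite /= mul1r ?mul0r ?mul1r.
have swap : cut_weight G T =
    \sum_u \sum_v (v \in T)%:R * (u \notin T)%:R * G u v.
  rewrite cutE exchange_big; apply: eq_bigr => u _; apply: eq_bigr => v _.
  by rewrite weight_sym.
have -> : 4 * cut_weight G T = 2 * (cut_weight G T + cut_weight G T) by ring.
rewrite {1}cutE swap -big_split mulr_sumr; apply: eq_bigr => u _ /=.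
rewrite -big_split mulr_sumr; apply: eq_bigr => v _ /=.
rewrite entry_cut_gram.
by case: (u \in T); case: (v \in T); rewrite /= ?expr0 ?expr1; ring.
Qed.

Lemma cut_weight_le_maxcut {R : realType} {V : finType} (G : wgraph R V)
    (T : {set V}) : cut_weight G T <= maxcut G.
Proof. exact: le_bigmax_cond. Qed.

Lemma maxcut_attained {R : realType} {V : finType} (G : wgraph R V) :
  exists T, maxcut G = cut_weight G T.
Proof.
rewrite /maxcut; elim/big_ind: _ => [|x y [S ->] [T ->]|T _].
- by exists set0; rewrite /cut_weight big_set0.
- by case: (leP (cut_weight G S) (cut_weight G T)); [exists T | exists S].
- by exists T.
Qed.

Lemma sdp_value_unique {R : realType} {V : finType} (G : wgraph R V) v w :
  sdp_value G v -> sdp_value G w -> v = w.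
Proof.
move=> [X [fX oX] <-] [Y [fY oY] <-].
by apply/le_anti; rewrite oX // oY.
Qed.

(** A cut whose weight is the value of the relaxation certifies exactness,
    since cuts are feasible points of the relaxation. *)
Lemma exact_graph_of_cut {R : realType} {V : finType} (G : wgraph R V) T :
  sdp_optimal G (cut_gram T) -> exact_graph G.
Proof.
move=> oT; exists (cut_gram T) => //; rewrite sdp_objective_cut_gram.
apply/le_anti; rewrite cut_weight_le_maxcut /=.
have [S ->] := maxcut_attained G; rewrite -!sdp_objective_cut_gram.
by apply: oT.2; exact: cut_gram_feasible.
Qed.

(** A maximum cut is feasible for the relaxation and, by exactness, has its
    value, so it is an optimal matrix. *)
Lemma exact_graph_cut {R : realType} {V : finType} (G : wgraph R V) :
  exact_graph G -> exists T, sdp_optimal G (cut_gram T).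
Proof.
case=> X [fX oX] Xm; have [T maxT] := maxcut_attained G.
exists T; split; first exact: cut_gram_feasible.
by move=> Y /oX; rewrite Xm maxT sdp_objective_cut_gram.
Qed.

(** * The objective on complete multipartite graphs *)

Lemma sum_tag {R : realType} {n : nat} (a : 'I_n -> nat) (F : 'I_n -> R) :
  \sum_(u : Kpart_vertex a) F (tag u) = \sum_i (a i)%:R * F i.
Proof.
rewrite -(sig_big_dep xpredT (fun=> xpredT) (fun i _ => F i)) /=.
by apply: eq_bigr => i _; rewrite sumr_const card_ord mulr_natl.
Qed.

(** The first double sum is |Y|^2 for Y the sum of all vectors; the second, a
    sum of nonnegative terms, measures how far the parts are from being sent
    to single points. *)
Lemma Kpart_objectiveE {R : realType} {n : nat} (a : 'I_n -> nat)
    (X : 'M[R]_#|Kpart_vertex a|) :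
  sdp_feasible X ->
  4 * sdp_objective (Kpart R a) X =
  (\sum_i (a i)%:R) ^+ 2 - \sum_u \sum_v entry X u v
  - \sum_(u : Kpart_vertex a) \sum_(v : Kpart_vertex a)
      (tag u == tag v)%:R * (1 - entry X u v).
Proof.
move=> fX; rewrite sdp_objectiveE //.
have -> : (\sum_i (a i)%:R) ^+ 2 =
    \sum_(u : Kpart_vertex a) \sum_(v : Kpart_vertex a) 1 :> R.
  under [X in X ^+ 2]eq_bigr do rewrite -[_%:R]mulr1.
  rewrite -(sum_tag a (fun=> 1)) expr2 mulr_suml.
  by apply: eq_bigr => u _; rewrite mul1r.
rewrite -!sumrB; apply: eq_bigr => u _; rewrite -!sumrB.
apply: eq_bigr => v _; rewrite /= /Kpart_weight.
by case: eqP => _ /=; ring.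
Qed.

Lemma entry_sum_ge0 {R : realType} {V : finType} (X : 'M[R]_#|V|) :
  sdp_feasible X -> 0 <= \sum_u \sum_v entry X u v.
Proof.
move=> fX; have := entry_quad_ge0 X (fun=> 1) fX; congr (_ <= _).
by apply: eq_bigr => u _; apply: eq_bigr => v _; rewrite !mul1r.
Qed.

Lemma part_defect_ge0 {R : realType} {n : nat} (a : 'I_n -> nat)
    (X : 'M[R]_#|Kpart_vertex a|) (u v : Kpart_vertex a) :
  sdp_feasible X -> 0 <= (tag u == tag v)%:R * (1 - entry X u v).
Proof. by move=> fX; rewrite mulr_ge0 ?ler0n ?entry_le. Qed.

Lemma Kpart_objective_le {R : realType} {n : nat} (a : 'I_n -> nat)
    (X : 'M[R]_#|Kpart_vertex a|) :
  sdp_feasible X ->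
  4 * sdp_objective (Kpart R a) X <= (\sum_i (a i)%:R) ^+ 2.
Proof.
move=> fX; rewrite Kpart_objectiveE // -subr_ge0.
have := entry_sum_ge0 X fX.
have : 0 <= \sum_(u : Kpart_vertex a) \sum_(v : Kpart_vertex a)
      (tag u == tag v)%:R * (1 - entry X u v).
  by do 2!apply: sumr_ge0 => ? _; exact: part_defect_ge0.
by lra.
Qed.

Lemma Kpart_objective_eq {R : realType} {n : nat} (a : 'I_n -> nat)
    (X : 'M[R]_#|Kpart_vertex a|) :
  sdp_feasible X ->
  4 * sdp_objective (Kpart R a) X = (\sum_i (a i)%:R) ^+ 2 ->
  \sum_u \sum_v entry X u v = 0 /\
  (forall u v : Kpart_vertex a, tag u = tag v -> entry X u v = 1).
Proof.
move=> fX; rewrite Kpart_objectiveE // => /eqP.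
have s0 := entry_sum_ge0 X fX.
have d0 (u : Kpart_vertex a) : 0 <= \sum_(v : Kpart_vertex a)
    (tag u == tag v)%:R * (1 - entry X u v).
  by apply: sumr_ge0 => v _; exact: part_defect_ge0.
set D := (X in _ - _ - X == _) => /eqP eqN.
have D0 : 0 <= D by apply: sumr_ge0 => u _; exact: d0.
have [sE DE] : \sum_u \sum_v entry X u v = 0 /\ D = 0.
  by split; apply/le_anti/andP; split=> //; lra.
split=> // u v uv.
have /(_ u isT) := psumr_eq0P (fun u _ => d0 u) DE.
move/(psumr_eq0P (fun v _ => part_defect_ge0 a X u v fX))/(_ v isT).
by rewrite uv eqxx mul1r => /subr0_eq.
Qed.

(** The steps a_i z_i with z_i = (x i, y i) form a closed polygon with side
    lengths a_i. Two dimensions suffice for all optimal matrices of value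
    N^2/4 that are needed, the balanced cuts being the case y = 0. *)
Definition closed_config {R : realType} {n : nat} (a : 'I_n -> nat)
    (x y : 'I_n -> R) : Prop :=
  [/\ forall i, x i ^+ 2 + y i ^+ 2 = 1,
      \sum_i (a i)%:R * x i = 0 & \sum_i (a i)%:R * y i = 0].

Definition config_gram {R : realType} {n : nat} (a : 'I_n -> nat)
    (x y : 'I_n -> R) : 'M[R]_#|Kpart_vertex a| :=
  planar_gram (x \o @tag _ _) (y \o @tag _ _).

(** A closed polygon with sides a_i makes both error terms of
    [Kpart_objectiveE] vanish. *)
Lemma closed_config_optimal {R : realType} {n : nat} (a : 'I_n -> nat)
    (x y : 'I_n -> R) :
  closed_config a x y ->
  sdp_optimal (Kpart R a) (config_gram a x y) /\
  4 * sdp_objective (Kpart R a) (config_gram a x y)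
    = (\sum_i (a i)%:R) ^+ 2.
Proof.
case=> unit_xy x0 y0.
have fX : sdp_feasible (config_gram a x y).
  by apply: planar_gram_feasible => u /=.
have objX : 4 * sdp_objective (Kpart R a) (config_gram a x y)
    = (\sum_i (a i)%:R) ^+ 2.
  rewrite Kpart_objectiveE //.
  have -> : \sum_u \sum_v entry (config_gram a x y) u v
      = (\sum_i (a i)%:R * x i) ^+ 2 + (\sum_i (a i)%:R * y i) ^+ 2.
    rewrite -!sum_tag !expr2 !mulr_suml -big_split; apply: eq_bigr => u _ /=.
    rewrite !mulr_sumr -big_split; apply: eq_bigr => v _ /=.
    by rewrite entry_planar_gram.
  rewrite x0 y0 expr0n addr0 subr0 [X in _ - X]big1 ?subr0 // => u _.
  rewrite big1 // => v _; case: eqP => [uv|_]; last by rewrite mul0r.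
  by rewrite entry_planar_gram /= uv -!expr2 unit_xy subrr mulr0.
split=> //; split=> // Y /Kpart_objective_le; rewrite -objX.
by rewrite ler_pM2l ?ltr0n.
Qed.

Lemma signed_sum {R : realType} {n : nat} (a : 'I_n -> nat) (S : {set 'I_n}) :
  \sum_i (a i)%:R * (-1) ^+ (i \in S) =
  (\sum_(i in ~: S) a i)%:R - (\sum_(i in S) a i)%:R :> R.
Proof.
rewrite !natr_sum !(big_mkcond (fun i => i \in _)) -sumrB.
apply: eq_bigr => i _; rewrite inE.
by case: (i \in S) => /=; rewrite ?expr0 ?expr1; ring.
Qed.

Definition balanced {n : nat} (a : 'I_n -> nat) (S : {set 'I_n}) : Prop :=
  (\sum_(i in S) a i = \sum_(i in ~: S) a i)%N.

Lemma total_halves {n : nat} (a : 'I_n -> nat) (S : {set 'I_n}) :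
  (\sum_i a i = \sum_(i in S) a i + \sum_(i in ~: S) a i)%N.
Proof.
rewrite (bigID (mem S)) /=; congr (_ + _)%N.
by apply: eq_bigl => i; rewrite inE.
Qed.

Lemma balanced_closed_config {R : realType} {n : nat} (a : 'I_n -> nat)
    (S : {set 'I_n}) :
  balanced a S ->
  @closed_config R n a (fun i => (-1) ^+ (i \in S)) (fun=> 0).
Proof.
move=> balS; split=> [i||]; first by rewrite expr0n addr0 sqrr_sign.
  by rewrite signed_sum balS subrr.
by rewrite big1 // => i _; rewrite mulr0.
Qed.

Lemma config_gram_signs {R : realType} {n : nat} (a : 'I_n -> nat)
    (S : {set 'I_n}) :
  config_gram a (fun i => (-1) ^+ (i \in S)) (fun=> 0)
  = cut_gram [set u | tag u \in S] :> 'M[R]__.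
Proof.
apply: entry_inj => u v.
by rewrite entry_cut_gram entry_planar_gram /= mulr0 addr0 !inE.
Qed.

(** In a cut of weight N ^ 2 / 4 each part lies on one side, for the defect
    inside the parts vanishes; the signs of the parts then sum to zero. *)
Lemma balanced_of_cut {R : realType} {n : nat} (a : 'I_n -> nat)
    (T : {set Kpart_vertex a}) :
  4 * sdp_objective (Kpart R a) (cut_gram T) = (\sum_i (a i)%:R) ^+ 2 ->
  exists S : {set 'I_n}, balanced a S.
Proof.
move/(Kpart_objective_eq a _ (cut_gram_feasible T)) => [sum0 part1].
pose S := [set i | [exists u in T, tag u == i]].
have TS u : (u \in T) = (tag u \in S).
  rewrite inE; apply/idP/existsP => [uT|[v /andP[vT /eqP vu]]].
    by exists u; rewrite uT eqxx.
  have := part1 _ _ vu; rewrite entry_cut_gram vT.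
  case: (u \in T) => //; rewrite expr0 expr1 mulr1 => h.
  by exfalso; lra.
exists S; apply/eqP; rewrite /balanced -(eqr_nat R) eq_sym -subr_eq0.
rewrite -signed_sum -sum_tag -sqrf_eq0 expr2 mulr_suml; apply/eqP.
rewrite -[RHS]sum0; apply: eq_bigr => u _; rewrite mulr_sumr.
by apply: eq_bigr => v _; rewrite entry_cut_gram !TS.
Qed.

(** * The dominating case *)

(** [pull X m u] is the inner product of x_u with the sum of x_u + x_v over the
    vertices v outside part m, so it measures how far those x_v are from
    being antipodal to x_u. *)
Definition pull {R : realType} {n : nat} {a : 'I_n -> nat}
    (X : 'M[R]_#|Kpart_vertex a|) (m : 'I_n) (u : Kpart_vertex a) : R :=
  \sum_(v : Kpart_vertex a) (tag v != m)%:R * (1 + entry X u v).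

Lemma sum_in_part {R : realType} {n : nat} (a : 'I_n -> nat) (m : 'I_n) :
  \sum_(u : Kpart_vertex a) (tag u == m)%:R = (a m)%:R :> R.
Proof.
rewrite (sum_tag a (fun i => (i == m)%:R)).
rewrite -[RHS](sum_pred1 (fun i => (a i)%:R)).
by apply: eq_bigr => i _; rewrite mulrC.
Qed.

Lemma sum_off_part {R : realType} {n : nat} (a : 'I_n -> nat) (m : 'I_n) :
  \sum_(u : Kpart_vertex a) (tag u != m)%:R
  = (\sum_(i | i != m) a i)%N%:R :> R.
Proof.
rewrite (sum_tag a (fun i => (i != m)%:R)) natr_sum [RHS]big_mkcond.
by apply: eq_bigr => i _; case: (i == m); rewrite ?mulr0 ?mulr1.
Qed.

(** With W the sum of the x_v outside part m and B their number, this is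
    (W . x_u) ^ 2 <= |W| ^ 2, because pull X m u = B + W . x_u and the left
    side is B ^ 2 - |W| ^ 2. *)
Lemma off_part_defect_le {R : realType} {n : nat} {a : 'I_n -> nat}
    (X : 'M[R]_#|Kpart_vertex a|) (m : 'I_n) (u : Kpart_vertex a) :
  sdp_feasible X ->
  \sum_(v : Kpart_vertex a) \sum_(w : Kpart_vertex a)
    (tag v != m)%:R * (tag w != m)%:R * (1 - entry X v w)
  <= 2 * (\sum_(i | i != m) a i)%N%:R * pull X m u - pull X m u ^+ 2.
Proof.
move=> fX; rewrite /pull -sum_off_part.
have := entry_cauchy_schwarz X (fun v => (tag v != m)%:R) u fX.
set W2 := (X in _ <= X) => cs.
under [X in _ <= 2 * _ * X - _]eq_bigr do rewrite mulrDr mulr1.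
under [X in _ <= _ - X ^+ 2]eq_bigr do rewrite mulrDr mulr1.
rewrite !big_split /=.
have -> : \sum_(v : Kpart_vertex a) \sum_(w : Kpart_vertex a)
    (tag v != m)%:R * (tag w != m)%:R * (1 - entry X v w)
    = (\sum_(u : Kpart_vertex a) (tag u != m)%:R) ^+ 2 - W2.
  rewrite expr2 mulr_suml -sumrB; apply: eq_bigr => v _.
  rewrite mulr_sumr -sumrB; apply: eq_bigr => w _.
  by rewrite mulrBr mulr1.
by nra.
Qed.

(** The dual certificate: writing A and B for the sizes of part m and of its
    complement, C for the sum of the pulls of part m and D for the defect
    outside part m, one has 4 * objective <= 4 A B - 2 C + D, and averaging
    the previous bound over part m gives A D <= 2 B C - (squares). Now B <= A
    and C >= 0. *)
Lemma dominating_bound {R : realType} {n : nat} {a : 'I_n -> nat}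
    (X : 'M[R]_#|Kpart_vertex a|) (m : 'I_n) :
  sdp_feasible X -> (\sum_(i | i != m) a i <= a m)%N ->
  \sum_(u : Kpart_vertex a) (tag u == m)%:R * pull X m u ^+ 2
  <= 4 * (a m)%:R *
     ((a m * \sum_(i | i != m) a i)%N%:R - sdp_objective (Kpart R a) X).
Proof.
move=> fX; rewrite -(ler_nat R) natrM.
set A := (a m)%:R; set B := (_%:R : R) => BA.
pose p (u : Kpart_vertex a) : R := (tag u == m)%:R.
pose q (u : Kpart_vertex a) : R := (tag u != m)%:R.
pose C := \sum_u p u * pull X m u.
pose D := \sum_u \sum_v q u * q v * (1 - entry X u v).
have sp : \sum_u p u = A by exact: sum_in_part.
have sq : \sum_u q u = B by exact: sum_off_part.
have p01 u : 0 <= p u by exact: ler0n.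
have C0 : 0 <= C.
  apply: sumr_ge0 => u _; rewrite mulr_ge0 //; apply: sumr_ge0 => v _.
  by rewrite mulr_ge0 ?ler0n ?entry_ge.
have pq1 : \sum_u \sum_v p u * q v * (1 - entry X u v) = 2 * (A * B) - C.
  rewrite -sp -sq mulr_suml mulr_sumr -sumrB; apply: eq_bigr => u _.
  rewrite /pull !mulr_sumr -sumrB; apply: eq_bigr => v _.
  by rewrite -/(q v); ring.
have objD : 4 * sdp_objective (Kpart R a) X <= 4 * (A * B) - 2 * C + D.
  (* edges between part m and the rest occur in both orders *)
  have -> : 4 * (A * B) - 2 * C + D =
      (2 * (A * B) - C) + (2 * (A * B) - C) + D by ring.
  rewrite -{1}pq1 -pq1 [X in _ + X + _]exchange_big -!big_split /=.
  rewrite sdp_objectiveE //; apply: ler_sum => u _.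
  rewrite -!big_split; apply: ler_sum => v _ /=.
  rewrite (entry_sym X v u) // -!mulrDl ler_wpM2r ?entry_le //.
  rewrite /Kpart_weight /p /q.
  case: (tag u =P m) => [->|_]; case: (tag v =P m) => [->|_] /=;
    rewrite ?eqxx ?mulr0 ?mul0r ?mulr1 ?add0r ?addr0 ?ler0n ?lern1 //;
    by case: (_ == _).
have AD : A * D <= 2 * B * C - \sum_u p u * pull X m u ^+ 2.
  rewrite -sp mulr_suml /C mulr_sumr -sumrB; apply: ler_sum => u _.
  rewrite mulrCA -mulrBr ler_wpM2l //; exact: off_part_defect_le.
have A0 : 0 <= A by exact: ler0n.
rewrite -/p; nra.
Qed.

Definition part_cut {n : nat} (a : 'I_n -> nat) (m : 'I_n) :
    {set Kpart_vertex a} := [set u | tag u == m].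

Lemma part_cut_objective {R : realType} {n : nat} (a : 'I_n -> nat) (m : 'I_n) :
  sdp_objective (Kpart R a) (cut_gram (part_cut a m))
  = (a m * \sum_(i | i != m) a i)%N%:R.
Proof.
rewrite sdp_objective_cut_gram /cut_weight natrM -sum_in_part -sum_off_part.
rewrite mulr_suml big_mkcond; apply: eq_bigr => u _; rewrite inE.
case: eqP => [um|_]; last by rewrite mul0r.
rewrite mul1r big_mkcond; apply: eq_bigr => v _; rewrite !inE /=.
by rewrite /Kpart_weight um eq_sym; case: eqP.
Qed.

Lemma part_cut_optimal {R : realType} {n : nat} (a : 'I_n -> nat) (m : 'I_n) :
  (0 < a m)%N -> (\sum_(i | i != m) a i <= a m)%N ->
  sdp_optimal (Kpart R a) (cut_gram (part_cut a m)).
Proof.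
move=> am dom; split=> [|Y fY]; first exact: cut_gram_feasible.
rewrite part_cut_objective.
have : 0 <= \sum_(u : Kpart_vertex a) (tag u == m)%:R * pull Y m u ^+ 2.
  by apply: sumr_ge0 => u _; rewrite mulr_ge0 ?ler0n ?sqr_ge0.
move/le_trans/(_ (dominating_bound Y m fY dom)).
by rewrite pmulr_rge0 ?subr_ge0 // mulr_gt0 ?ltr0n.
Qed.

(** At an optimum the pulls of part m vanish, so the vertices outside part m
    are antipodal to those of part m, and this determines all entries. *)
Lemma dominating_unique {R : realType} {n : nat} (a : 'I_n -> nat) (m k : 'I_n)
    (Y : 'M[R]_#|Kpart_vertex a|) :
  (0 < a m)%N -> (0 < a k)%N -> k != m -> (\sum_(i | i != m) a i <= a m)%N ->
  sdp_optimal (Kpart R a) Y -> Y = cut_gram (part_cut a m).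
Proof.
move=> am ak km dom [fY oY].
have Yobj : sdp_objective (Kpart R a) Y = (a m * \sum_(i | i != m) a i)%N%:R.
  have [_ oC] := @part_cut_optimal R n a m am dom.
  rewrite -part_cut_objective; apply/le_anti.
  by rewrite oC // oY //; exact: cut_gram_feasible.
have pull_sqr_ge0 (u : Kpart_vertex a) : 0 <= (tag u == m)%:R * pull Y m u ^+ 2.
  by rewrite mulr_ge0 ?ler0n ?sqr_ge0.
have sum0 : \sum_(u : Kpart_vertex a) (tag u == m)%:R * pull Y m u ^+ 2 = 0.
  apply/le_anti; rewrite sumr_ge0 // andbT.
  by have := dominating_bound Y m fY dom; rewrite Yobj subrr mulr0.
have anti (u v : Kpart_vertex a) :
    tag u = m -> tag v != m -> entry Y u v = -1.
  move=> um vm.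
  have /(_ u isT) := psumr_eq0P (fun u _ => pull_sqr_ge0 u) sum0.
  rewrite um eqxx mul1r => /eqP; rewrite sqrf_eq0 => /eqP pull0.
  have term_ge0 (w : Kpart_vertex a) :
      0 <= (tag w != m)%:R * (1 + entry Y u w).
    by rewrite mulr_ge0 ?ler0n ?entry_ge.
  have /(_ v isT) := psumr_eq0P (fun w _ => term_ge0 w) pull0.
  by rewrite vm mul1r => h; lra.
(* two vertices of the same side have a common antipode, w1 or w2 *)
pose w1 : Kpart_vertex a := Tagged _ (Ordinal am).
pose w2 : Kpart_vertex a := Tagged _ (Ordinal ak).
apply: entry_inj => u v; rewrite entry_cut_gram !inE.
have [um|um] := eqVneq (tag u) m; have [vm|vm] := eqVneq (tag v) m;
  rewrite /= ?expr0 ?expr1 ?mulr1 ?mul1r ?mulrNN ?mulr1.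
- by rewrite (entry_antipodal Y w2 u v) // ?(entry_sym Y w2) // !anti ?opprK.
- by rewrite anti.
- by rewrite entry_sym ?anti.
- by rewrite (entry_antipodal Y w1 u v) // !anti ?opprK.
Qed.

(** * Closed configurations in the non-dominating case *)

Lemma triangle_exists {R : realType} (p q d : R) :
  0 < p -> 0 < q -> 0 < d -> d <= p + q -> p <= d + q -> q <= d + p ->
  exists x y x' y' : R, [/\ x ^+ 2 + y ^+ 2 = 1, x' ^+ 2 + y' ^+ 2 = 1,
    p * x + q * x' = d & p * y + q * y' = 0].
Proof.
move=> p0 q0 d0 dpq pdq qdp.
(* the law of cosines gives the component of the side p along the side d *)
pose x := (d ^+ 2 + p ^+ 2 - q ^+ 2) / (2 * p * d).
have x_le1 : x ^+ 2 <= 1.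
  rewrite /x expr_div_n ler_pdivrMr ?exprn_gt0 ?mulr_gt0 ?ltr0n // mul1r.
  rewrite -subr_ge0.
  have -> : (2 * p * d) ^+ 2 - (d ^+ 2 + p ^+ 2 - q ^+ 2) ^+ 2
      = ((d + p + q) * (p + q - d)) * ((d + q - p) * (d + p - q)) by ring.
  by rewrite !mulr_ge0 //; lra.
pose y := Num.sqrt (1 - x ^+ 2).
have y2 : y ^+ 2 = 1 - x ^+ 2 by rewrite sqr_sqrtr // subr_ge0.
have px : 2 * d * (p * x) = d ^+ 2 + p ^+ 2 - q ^+ 2.
  by rewrite /x; field; rewrite !gt_eqF.
exists x, y, ((d - p * x) / q), (- (p * y) / q); split.
- by rewrite y2 addrC subrK.
- rewrite !expr_div_n -mulrDl sqrrN [(p * y) ^+ 2]exprMn y2.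
  have -> : (d - p * x) ^+ 2 + p ^+ 2 * (1 - x ^+ 2)
      = d ^+ 2 - 2 * d * (p * x) + p ^+ 2 by ring.
  by rewrite px; field; rewrite gt_eqF.
- by field; rewrite gt_eqF.
- by field; rewrite gt_eqF.
Qed.

(** With q the size of the group U and r that of the rest, the two bounds are
    the triangle inequalities q <= a m + r and r <= a m + q. A heaviest U
    satisfying the first also satisfies the second: otherwise one more part,
    of size at most a m, could be added. *)
Lemma triangle_grouping {n : nat} (a : 'I_n -> nat) (m : 'I_n) :
  (forall i, 0 < a i)%N -> (forall i, a i <= a m)%N ->
  (a m < \sum_(i | i != m) a i)%N ->
  exists U : {set 'I_n}, [/\ m \notin U,
    (2 * \sum_(i in U) a i <= a m + \sum_(i | i != m) a i)%N &
    (\sum_(i | i != m) a i <= a m + 2 * \sum_(i in U) a i)%N].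
Proof.
move=> a0 am nondom; set B := (\sum_(i | i != m) a i)%N in nondom *.
pose ok (U : {set 'I_n}) :=
  (m \notin U) && (2 * \sum_(i in U) a i <= a m + B)%N.
have ok0 : ok set0 by rewrite /ok inE big_set0 muln0.
case: (@arg_maxnP _ _ ok (fun U => \sum_(i in U) a i)%N ok0).
move=> U /andP[mU leU] maxU.
exists U; split=> //; rewrite leqNgt; apply/negP => light.
have [j jm jU] : exists2 j, j != m & j \notin U.
  apply/exists_inP; apply: contraLR light => /exists_inPn full.
  rewrite -leqNgt; apply: leq_trans (leq_addl _ _).
  rewrite mul2n -addnn; apply: leq_trans (leq_addl _ _).
  rewrite /B [X in (_ <= X)%N](bigID (fun i => i != m)) /=.
  apply: leq_trans (leq_addr _ _); apply: eq_leq; apply: eq_bigl => i.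
  by case: eqVneq => [_|/full]; rewrite ?andbF // negbK => ->.
have /maxU : ok (j |: U).
  rewrite /ok !inE negb_or eq_sym jm mU big_setU1 //=.
  by move: light (am j); set q := (\sum_(i in U) a i)%N; lia.
rewrite big_setU1 //=; apply/negP; rewrite -ltnNge -[X in (X < _)%N]add0n.
by rewrite ltn_add2r.
Qed.

(** Part m is sent to (-1, 0), which closes a triangle whose other two sides
    are the groups of [triangle_grouping]. *)
Lemma nondominating_closed_config {R : realType} {n : nat} (a : 'I_n -> nat)
    (m : 'I_n) :
  (forall i, 0 < a i)%N -> (forall i, a i <= a m)%N ->
  (a m < \sum_(i | i != m) a i)%N ->
  exists x y : 'I_n -> R, closed_config a x y.
Proof.
move=> a0 am nondom.
have [U [mU leU geU]] := triangle_grouping a m a0 am nondom.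
have split_sum (F : 'I_n -> R) : \sum_i F i
    = F m + (\sum_(i in U) F i + \sum_(i | (i != m) && (i \notin U)) F i).
  rewrite (bigD1 m) //= (bigID (mem U)) /=; congr (_ + (_ + _)).
  by apply: eq_bigl => i; case: eqVneq => [->|//]; rewrite (negPf mU).
pose q := (\sum_(i in U) a i)%N.
pose r := (\sum_(i | (i != m) && (i \notin U)) a i)%N.
have qr : (\sum_(i | i != m) a i = q + r)%N.
  rewrite (bigID (mem U)) /=; congr (_ + _)%N; apply: eq_bigl => i.
  by case: eqVneq => [->|//]; rewrite (negPf mU).
rewrite qr in nondom leU geU; rewrite -/q in leU geU.
have [||||||x [y [x' [y' [xy xy' X0 Y0]]]]] :=
  @triangle_exists R q%:R r%:R (a m)%:R; rewrite ?ltr0n // -?natrD ?ler_nat;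
  try by have := a0 m; lia.
pose sel (o s s' : R) i := if i == m then o else if i \in U then s else s'.
have sel_sum o s s' : \sum_i (a i)%:R * sel o s s' i
    = (a m)%:R * o + (q%:R * s + r%:R * s').
  rewrite split_sum /sel eqxx /q /r !natr_sum !mulr_suml.
  congr (_ + (_ + _)); apply: eq_bigr => i.
    by move=> iU; rewrite iU; case: eqP iU mU => // -> ->.
  by move=> /andP[/negPf-> /negPf->].
exists (sel (-1) x x'), (sel 0 y y'); split=> [i||].
- rewrite /sel; case: (i == m); first by rewrite sqrrN expr1n expr0n addr0.
  by case: (i \in U).
- by rewrite sel_sum X0 mulrN1 addNr.
- by rewrite sel_sum Y0 mulr0 addr0.
Qed.

(** Group a balanced instance into four sides with p + q = r + s = h, where p
    and q come from S. The quadrilateral need not be flat: as all sides are at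
    least 1, its diagonal may have length h - 1 instead of h, and then the
    sides p and q are not parallel. *)
Lemma balanced_bent_config {R : realType} {n : nat} (a : 'I_n.+1 -> nat)
    (S : {set 'I_n.+1}) :
  (forall i, 0 < a i)%N -> balanced a S ->
  (forall i, a i < \sum_(i in S) a i)%N ->
  exists (x y : 'I_n.+1 -> R) (i j : 'I_n.+1), [/\ closed_config a x y,
    i \in S, j \in S & x i * x j + y i * y j != 1].
Proof.
move=> a0 balS a_lt; pose h := (\sum_(i in S) a i)%N.
have pos_mem (P : pred 'I_n.+1) : (0 < \sum_(i | P i) a i)%N -> exists i, P i.
  move=> s0; apply/existsP; apply: contraLR s0 => /existsPn noP.
  by rewrite big1 // => i Pi; have := noP i; rewrite Pi.
have h0 : (0 < h)%N by apply: leq_ltn_trans (a_lt ord0).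
have [i iS] : exists i, i \in S by exact: pos_mem h0.
have hC : (\sum_(i in ~: S) a i)%N = h by rewrite -balS.
have [k] : exists k, k \in ~: S by apply: pos_mem; rewrite hC.
rewrite inE => kS.
pose q := (\sum_(l | (l \in S) && (l != i)) a l)%N.
pose s := (\sum_(l | (l \in ~: S) && (l != k)) a l)%N.
have pq : (a i + q = h)%N by rewrite /h (bigD1 i iS).
have rs : (a k + s = h)%N by rewrite -hC (bigD1 k) //= inE.
have [p0 r0] := (a0 i, a0 k).
have q0 : (0 < q)%N by have := a_lt i; rewrite -/h; lia.
have s0 : (0 < s)%N by have := a_lt k; rewrite -/h; lia.
have [j /andP[jS ji]] := pos_mem (fun l => (l \in S) && (l != i)) q0.
have [||||||x [y [x' [y' [xy xy' X0 Y0]]]]] :=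
  @triangle_exists R (a i)%:R q%:R h.-1%:R; rewrite ?ltr0n // -?natrD ?ler_nat;
  try by lia.
have [||||||z [t [z' [t' [zt zt' Z0 T0]]]]] :=
  @triangle_exists R (a k)%:R s%:R h.-1%:R; rewrite ?ltr0n // -?natrD ?ler_nat;
  try by lia.
pose sel (o1 o2 o3 o4 : R) l :=
  if l \in S then if l == i then o1 else o2
  else if l == k then - o3 else - o4.
have sel_sum o1 o2 o3 o4 : \sum_l (a l)%:R * sel o1 o2 o3 o4 l
    = ((a i)%:R * o1 + q%:R * o2) - ((a k)%:R * o3 + s%:R * o4).
  rewrite (bigID (mem S)) /= (bigD1 i iS) (bigD1 k kS) /= /sel.
  rewrite iS (negPf kS) !eqxx /q /s !natr_sum !mulr_suml opprD -mulrN -sumrN.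
  congr (_ + _ + (_ + _)).
    apply: eq_bigr => l /andP[lS /negPf->].
    by have -> : l \in S by [].
  apply: eq_big => [l|l /andP[/negPf-> /negPf->]]; first by rewrite inE.
  by rewrite mulrN.
exists (sel x x' z z'), (sel y y' t t'), i, j; split=> //.
  split=> [l||].
  - rewrite /sel; case: (l \in S).
      by case: (l == i).
    by case: (l == k); rewrite !sqrrN.
  - by rewrite sel_sum X0 Z0 subrr.
  - by rewrite sel_sum Y0 T0 subrr.
rewrite /sel iS jS eqxx (negPf ji); apply/eqP => par.
(* parallel sides would give the diagonal length p + q = h, not h - 1 *)
have bent : ((a i)%:R * x + q%:R * x') ^+ 2 + ((a i)%:R * y + q%:R * y') ^+ 2
    = ((a i)%:R + q%:R) ^+ 2 :> R.
  transitivity ((a i)%:R ^+ 2 * (x ^+ 2 + y ^+ 2)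
    + q%:R ^+ 2 * (x' ^+ 2 + y' ^+ 2)
    + 2 * (a i)%:R * q%:R * (x * x' + y * y')); first by ring.
  by rewrite xy xy' par; ring.
move/eqP: bent; rewrite X0 Y0 expr0n addr0 -natrD pq -!natrX eqr_nat.
by rewrite eqn_exp2r // -[X in _ == X](prednK h0) ltn_eqF.
Qed.

(** * Exactness of complete multipartite graphs *)

Theorem proposition11 (R : realType) (n : nat) (a : 'I_n.+2 -> nat)
    (a_ge1 : forall i : 'I_n.+2, (1 <= a i)%N)
    (a_mono : forall i j : 'I_n.+2, (i <= j)%N -> (a i <= a j)%N) :
  [/\ exact_graph (Kpart R a) <->
        ((exists S : {set 'I_n.+2},
            (\sum_(i in S) a i = \sum_(i in ~: S) a i)%N) \/
         (\sum_(i | i != ord_max) a i <= a ord_max)%N),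
      forall S : {set 'I_n.+2},
        (\sum_(i in S) a i = \sum_(i in ~: S) a i)%N ->
        sdp_value (Kpart R a) ((\sum_(i in S) a i) ^ 2)%N%:R,
      (\sum_(i | i != ord_max) a i <= a ord_max)%N ->
        sdp_value (Kpart R a) (a ord_max * \sum_(i | i != ord_max) a i)%N%:R &
      exact_graph (Kpart R a) ->
        ((exists! X, sdp_optimal (Kpart R a) X) <->
         (\sum_(i | i != ord_max) a i <= a ord_max)%N)].
Proof.
pose m := @ord_max n.+1.
have a_max i : (a i <= a m)%N by apply: a_mono; exact: leq_ord.
have bal_opt (S : {set 'I_n.+2}) : balanced a S ->
    sdp_optimal (Kpart R a) (cut_gram [set u | tag u \in S]) /\
    4 * sdp_objective (Kpart R a) (cut_gram [set u | tag u \in S])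
      = (\sum_i (a i)%:R) ^+ 2.
  move=> balS; rewrite -config_gram_signs.
  exact: closed_config_optimal (balanced_closed_config a S balS).
have exact_bal : exact_graph (Kpart R a) ->
    (a m < \sum_(i | i != m) a i)%N -> exists S, balanced a S.
  move=> /exact_graph_cut [T oT] nondom.
  have [x [y cxy]] :=
    nondominating_closed_config (R := R) a m a_ge1 a_max nondom.
  have [oX objX] := closed_config_optimal a x y cxy.
  apply: (@balanced_of_cut R _ a T); rewrite -objX; congr (_ * _).
  apply: (@sdp_value_unique _ _ (Kpart R a)); first by exists (cut_gram T).
  by exists (config_gram a x y).
split.
- split=> [ex|[[S balS]|dom]].
  + case: (leqP (\sum_(i | i != m) a i) (a m)) => [|nondom]; first by right.
    by left; apply: exact_bal.
  + by apply: exact_graph_of_cut; exact: (bal_opt S balS).1.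
  + apply: exact_graph_of_cut; exact: (part_cut_optimal a m).
- move=> S balS; have [oS objS] := bal_opt S balS.
  exists (cut_gram [set u | tag u \in S]) => //.
  apply: (@mulfI _ 4); rewrite ?pnatr_eq0 // objS -natr_sum.
  by rewrite (total_halves a S) -balS -!natrX -natrM addnn -mul2n expnMn.
- move=> dom; exists (cut_gram (part_cut a m)); first exact: part_cut_optimal.
  exact: part_cut_objective.
move=> ex; split=> [[X [_ uniqX]]|dom].
  rewrite leqNgt; apply/negP => nondom.
  have [S balS] := exact_bal ex nondom.
  have total := total_halves a S; rewrite (bigD1 m) //= -balS in total.
  have a_lt i : (a i < \sum_(i in S) a i)%N.
    move: nondom total (a_max i); rewrite -/m.
    set h := (\sum_(i in S) a i)%N; set B := (\sum_(i | i != m) a i)%N; lia.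
  (* the bent quadrilateral gives an entry other than 1 between two parts of
     the same side S, where the cut has the entry 1 *)
  have [x [y [i [j [cxy iS jS]]]]] :=
    @balanced_bent_config R _ a S a_ge1 balS a_lt.
  have [oX _] := closed_config_optimal a x y cxy.
  have [oS _] := bal_opt S balS.
  have XS : config_gram a x y = cut_gram [set u | tag u \in S].
    by rewrite -(uniqX _ oX) -(uniqX _ oS).
  pose u : Kpart_vertex a := Tagged _ (Ordinal (a_ge1 i)).
  pose v : Kpart_vertex a := Tagged _ (Ordinal (a_ge1 j)).
  have := congr1 (fun Y => entry Y u v) XS.
  rewrite /= entry_planar_gram entry_cut_gram !inE /= iS jS => ->.
  by rewrite mulrNN mulr1 eqxx.
exists (cut_gram (part_cut a m)); split; first exact: part_cut_optimal.
move=> Y oY; apply/esym.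
have k0 : ord0 != m by [].
exact: (dominating_unique a m ord0 Y).
Qed.
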